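(* Let $K$ be a field of characteristic zero, let $n\ge 2$, and let $f\in K[x_1,\ldots,x_{n+1}]$ be a quadratic form such that the $n$-Lie algebra $\mathbb{L}(f)$ is simple. Let $P(\mathbb{L}(f))$ be the $n$-Lie-Poisson enveloping algebra of $\mathbb{L}(f)$. Then the quotient algebra $P(\mathbb{L}(f))/(f-\lambda)$ is central and simple for any $0\neq\lambda\in K$.
   Context: An $n$-Lie algebra is a vector space with an $n$-ary multilinear skew-symmetric bracket satisfying $[[u_1,\ldots,u_n],v_1,\ldots,v_{n-1}]=\sum_{i=1}^n[u_1,\ldots,u_{i-1},[u_i,v_1,\ldots,v_{n-1}],u_{i+1},\ldots,u_n]$. For a quadratic form $f\in K[x_1,\ldots,x_{n+1}]$, $\mathbb{L}(f)$ (also written $\mathbb{L}_n(f)$) is the $n$-Lie algebra with basis $e_1,\ldots,e_{n+1}$ and bracket $[e_1,\ldots,\widehat{e_i},\ldots,e_{n+1}]=(-1)^{n-i+1}\frac{\partial f}{\partial x_i}(e_1,\ldots,e_{n+1})$, $1\le i\le n+1$, where $\widehat{e_i}$ means that $e_i$ is omitted. It is known that $\mathbb{L}(f)$ is simple if and only if $f$ is non-degenerate. The $n$-Lie-Poisson enveloping algebra $P(\mathbb{L}(f))$ is the polynomial algebra $K[e_1,\ldots,e_{n+1}]$ with the unique $n$-ary skew-symmetric multilinear bracket that is a derivation in each argument and satisfies $\{e_{i_1},\ldots,e_{i_n}\}=[e_{i_1},\ldots,e_{i_n}]$. Identifying $e_i$ with $x_i$, it is $K[x_1,\ldots,x_{n+1}]$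 with bracket $\{g_1,\ldots,g_n\}=J(g_1,\ldots,g_n,f)$, where $J$ is the Jacobian determinant. Under this identification, $f$ is a central element of $P(\mathbb{L}(f))$, and $(f-\lambda)$ is the ideal of the polynomial algebra generated by $f-\lambda$; the quotient carries the induced product and bracket. Such an algebra $P$ is central if $Z(P)=\{c\in P:\{c,g_2,\ldots,g_n\}=0\ \text{for all }g_2,\ldots,g_n\in P\}$ equals $K$, and simple if the only ideals $I$ of the commutative associative algebra $P$ with $\{P,\ldots,P,I\}\subseteq I$ are $0$ and $P$. *)

(* Defs.v *)
From HB Require Import structures.
From mathcomp Require Import all_boot all_order all_fingroup all_algebra.
From mathcomp Require Import generic_quotient ring_quotient boolp.
From mathcomp Require Import mpoly.

Set Implicit Arguments.
Unset Strict Implicit.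
Unset Printing Implicit Defensive.

Import GRing.Theory.
Local Open Scope ring_scope.

(* An n-tuple of arguments (u_1, ..., u_n) is a finite function on 'I_n, so
   positions are numbered from 0. *)

Definition set_at (n : nat) (T : Type) (i : 'I_n) (x : T) (u : {ffun 'I_n -> T}) :
  {ffun 'I_n -> T} := [ffun j => if j == i then x else u j].

Section Brackets.
Variables (K : fieldType) (n : nat) (V : zmodType).
Implicit Type br : {ffun 'I_n -> V} -> V.

(* The scalar action is an explicit argument, because the predicate is used for
   left modules and for algebras given by a structure morphism. *)
Definition multilinear (act : K -> V -> V) br : Prop :=
  forall (u : {ffun 'I_n -> V}) (i : 'I_n) (a : K) (x y : V),
    br (set_at i (act a x + y) u) = act a (br (set_at i x u)) + br (set_at i y u).

Definition skew_symmetric br : Prop :=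
  forall (u : {ffun 'I_n -> V}) (s : 'S_n),
    br [ffun i => u (s i)] = if odd_perm s then - br u else br u.

(* [x, v_1, ..., v_(n-1)] is encoded as [br (set_at i0 x v)] with [i0] the first
   position; the entry of [v] at [i0] is irrelevant. *)
Definition filippov_identity br : Prop :=
  forall (u v : {ffun 'I_n -> V}) (i0 : 'I_n), i0 = 0%N :> nat ->
    br (set_at i0 (br u) v) =
    \sum_(i < n) br (set_at i (br (set_at i0 (u i) v)) u).

End Brackets.

Record nLieAlgebra (K : fieldType) (n : nat) := NLieAlgebra {
  nlie_sort :> lmodType K;
  nlie_br : {ffun 'I_n -> nlie_sort} -> nlie_sort;
  nlie_multilinear : multilinear *:%R nlie_br;
  nlie_skew : skew_symmetric nlie_br;
  nlie_filippov : filippov_identity nlie_br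
}.

Section NLieIdeals.
Variables (K : fieldType) (n : nat) (L : nLieAlgebra K n).

Definition nlie_ideal (I : L -> Prop) : Prop :=
  [/\ I 0,
      forall (a : K) (x y : L), I x -> I y -> I (a *: x + y)
    & forall (u : {ffun 'I_n -> L}) (i : 'I_n),
        i.+1 = n :> nat -> I (u i) -> I (nlie_br u)].

(* An n-Lie algebra with zero bracket is not simple. *)
Definition nlie_simple : Prop :=
  (exists u : {ffun 'I_n -> L}, nlie_br u <> 0) /\
  (forall I : L -> Prop, nlie_ideal I ->
     (forall x, I x -> x = 0) \/ (forall x, I x)).

End NLieIdeals.

(* A commutative unital K-algebra is a commutative ring with a structure
   morphism from K.  The library's [comAlgType] is not used because it is
   non-trivial by construction, whereas the quotient of a polynomial ring by
   f - lambda is zero when f = 0 and lambda != 0. *)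
Record nLiePoissonAlgebra (K : fieldType) (n : nat) := NLiePoissonAlgebra {
  nlp_sort :> comPzRingType;
  nlp_scalar : {rmorphism K -> nlp_sort};
  nlp_br : {ffun 'I_n -> nlp_sort} -> nlp_sort;
  nlp_multilinear : multilinear (fun a x => nlp_scalar a * x) nlp_br;
  nlp_skew : skew_symmetric nlp_br;
  nlp_filippov : filippov_identity nlp_br;
  nlp_leibniz : forall (u : {ffun 'I_n -> nlp_sort}) (i : 'I_n) (x y : nlp_sort),
    nlp_br (set_at i (x * y) u) =
    x * nlp_br (set_at i y u) + nlp_br (set_at i x u) * y
}.

Section NLiePoissonTheory.
Variables (K : fieldType) (n : nat) (P : nLiePoissonAlgebra K n).

Definition nlp_center (c : P) : Prop :=
  forall (g : {ffun 'I_n -> P}) (i : 'I_n),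
    i = 0%N :> nat -> nlp_br (set_at i c g) = 0.

(* Z(P) = K, where K is identified with its image in P; this requires the
   structure morphism to be injective, that is, P != 0. *)
Definition nlp_central : Prop :=
  injective (nlp_scalar P) /\
  (forall c : P, nlp_center c <-> exists a : K, c = nlp_scalar P a).

(* Stability under scalars is a case of stability under multiplication. *)
Definition nlp_ideal (I : P -> Prop) : Prop :=
  [/\ I 0,
      forall x y : P, I x -> I y -> I (x + y),
      forall x y : P, I y -> I (x * y)
    & forall (g : {ffun 'I_n -> P}) (i : 'I_n),
        i.+1 = n :> nat -> I (g i) -> I (nlp_br g)].

Definition nlp_simple : Prop :=
  forall I : P -> Prop, nlp_ideal I ->
    (forall x, I x -> x = 0) \/ (forall x, I x).

End NLiePoissonTheory.

Section Tuples.
Variables (n : nat) (T : Type).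
Implicit Types (u : {ffun 'I_n -> T}).

Lemma set_atE i (x : T) u : set_at i x u i = x.
Proof. by rewrite ffunE eqxx. Qed.

Lemma set_at_id i u : set_at i (u i) u = u.
Proof. by apply/ffunP => j; rewrite ffunE; case: eqP => [->|]. Qed.

Lemma set_atC i k (x y : T) u : i != k ->
  set_at i x (set_at k y u) = set_at k y (set_at i x u).
Proof.
move=> ik; apply/ffunP => j; rewrite !ffunE.
by case: (eqVneq j i) => [->|//]; rewrite (negPf ik).
Qed.

Lemma set_at_set i (x y : T) u : set_at i x (set_at i y u) = set_at i x u.
Proof. by apply/ffunP => j; rewrite !ffunE; case: eqP. Qed.

(* (u_1, ..., u_n, y) *)
Definition stack u (y : T) : {ffun 'I_n.+1 -> T} :=
  [ffun i => oapp u y (unlift ord_max i)].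

Lemma stack_max u y : stack u y ord_max = y.
Proof. by rewrite ffunE unlift_none. Qed.

Lemma stack_lift u y i : stack u y (lift ord_max i) = u i.
Proof. by rewrite ffunE liftK. Qed.

Lemma stack_set u y i x :
  stack (set_at i x u) y = set_at (lift ord_max i) x (stack u y).
Proof.
apply/ffunP => j; rewrite !ffunE; case: unliftP => [k ->|->] /=.
  by rewrite ffunE (inj_eq lift_inj).
by rewrite (negPf (neq_lift _ _)).
Qed.

Lemma stack_setmax u y z : stack u y = set_at ord_max y (stack u z).
Proof.
apply/ffunP => j; rewrite !ffunE; case: unliftP => [k ->|->] /=.
  by rewrite eq_sym (negPf (neq_lift _ _)).
by rewrite eqxx.
Qed.

Lemma stack_perm u y (s : 'S_n) :
  stack [ffun i => u (s i)] y =
  [ffun i => stack u y (lift_perm ord_max ord_max s i)].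
Proof.
apply/ffunP => j; rewrite !ffunE; case: (unliftP ord_max j) => [k ->|->] /=.
  by rewrite lift_perm_lift liftK ffunE.
by rewrite lift_perm_id unlift_none.
Qed.

End Tuples.

Section RowDeterminants.
Variables (R : comNzRingType) (m : nat).
Implicit Types (h : {ffun 'I_m -> 'rV[R]_m}).

Definition rdet h : R := \det (\matrix_i h i).

Lemma rdet_expand h i r :
  rdet (set_at i r h) = \sum_j r 0 j * cofactor (\matrix_i h i) i j.
Proof.
rewrite /rdet (expand_det_row _ i); apply: eq_bigr => j _.
rewrite !mxE set_atE; congr (_ * (_ * \det _)).
apply/matrixP => k l; rewrite !mxE ffunE.
by rewrite eq_sym (negPf (neq_lift _ _)).
Qed.

Lemma rdet_lin h i a x y :
  rdet (set_at i (a *: x + y) h) =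
  a * rdet (set_at i x h) + rdet (set_at i y h).
Proof.
rewrite !rdet_expand mulr_sumr -big_split /=; apply: eq_bigr => j _.
by rewrite !mxE mulrDl mulrA.
Qed.

Lemma rdet_sum h i (I : finType) (c : I -> R) (x : I -> 'rV_m) :
  rdet (set_at i (\sum_j c j *: x j) h) =
  \sum_j c j * rdet (set_at i (x j) h).
Proof.
have lin0 y : rdet (set_at i (y - y) h) = 0.
  by have := rdet_lin h i (-1) y y; rewrite scaleN1r addrC mulN1r addNr.
elim/big_rec2: _ => [|j t s _ <-]; first by rewrite -(subrr 0) lin0.
by rewrite rdet_lin.
Qed.

Lemma rdet_row h i r :
  rdet (set_at i r h) = \sum_j r 0 j * rdet (set_at i (delta_mx 0 j) h).
Proof. by rewrite {1}[r]row_sum_delta rdet_sum. Qed.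

Lemma rdet_alt h i k : i != k -> h i = h k -> rdet h = 0.
Proof.
by move=> ik hik; apply: (determinant_alternate ik) => j; rewrite !mxE hik.
Qed.

Lemma rdet_perm h (s : 'S_m) :
  rdet [ffun i => h (s i)] = (-1) ^+ (odd_perm s) * rdet h.
Proof.
rewrite /rdet -det_perm -det_mulmx -row_permE; congr (\det _).
by apply/matrixP => i j; rewrite !mxE ffunE.
Qed.

Lemma rdet_swap h i k x y : i != k ->
  rdet (set_at i x (set_at k y h)) = - rdet (set_at i y (set_at k x h)).
Proof.
move=> ik; have ki : k != i by rewrite eq_sym.
have alt z : rdet (set_at i z (set_at k z h)) = 0.
  by apply: (rdet_alt ik); rewrite set_atE ffunE (negPf ki) set_atE.
have linD r a b : rdet (set_at i (a + b) r) =
    rdet (set_at i a r) + rdet (set_at i b r).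
  by have := rdet_lin r i 1 a b; rewrite scale1r mul1r.
have linDk r a b : rdet (set_at k (a + b) r) =
    rdet (set_at k a r) + rdet (set_at k b r).
  by have := rdet_lin r k 1 a b; rewrite scale1r mul1r.
have := alt (x + y); rewrite linD !(set_atC _ _ _ ik) !linDk.
rewrite -!(set_atC _ _ _ ik) !alt add0r addr0 => /eqP.
by rewrite addr_eq0 => /eqP.
Qed.

(* The derivative of the determinant in the direction h |-> h N. *)
Lemma rdet_trace h (N : 'M_m) :
  \sum_i rdet (set_at i (h i *m N) h) = \tr N * rdet h.
Proof.
pose M := \matrix_i h i.
transitivity (\tr ((M *m N) *m \adj M)).
  rewrite /mxtrace; apply: eq_bigr => i _; rewrite rdet_expand mxE.
  apply: eq_bigr => j _; rewrite [\adj M j i]mxE; congr (_ * _).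
  by rewrite -[in LHS](rowK h i) -row_mul mxE.
by rewrite -mulmxA mxtrace_mulC -mulmxA mul_adj_mx mxtrace_mulC
  mul_scalar_mx mxtraceZ mulrC.
Qed.

Lemma rdet_sym0 h i k (H : 'M_m) : i != k -> H^T = H ->
  \sum_j \sum_l H j l *
    rdet (set_at i (delta_mx 0 j) (set_at k (delta_mx 0 l) h)) = 0.
Proof.
move=> ik Hs; pose T j l :=
  H j l * rdet (set_at i (delta_mx 0 j) (set_at k (delta_mx 0 l) h)).
have TN j l : T j l = - T l j.
  by rewrite /T rdet_swap // -{1}Hs mxE mulrN.
have T0 j : T j j = 0.
  rewrite /T (@rdet_alt _ i k) ?mulr0 // set_atE ffunE eq_sym (negPf ik).
  by rewrite set_atE.
rewrite pair_bigA /= -/(T _ _).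
rewrite (bigID (fun p : 'I_m * 'I_m => (p.1 < p.2)%N)) /=.
rewrite [X in _ + X](bigID (fun p : 'I_m * 'I_m => (p.2 < p.1)%N)) /=.
rewrite [X in _ + (_ + X)]big1 ?addr0; last first.
  move=> [j l] /=; rewrite -!leqNgt => /andP[h1 h2].
  have -> : j = l by apply/val_inj/anti_leq; rewrite h1 h2.
  exact: T0.
rewrite [X in _ + X](reindex_inj (h := fun p : 'I_m * 'I_m => (p.2, p.1))) /=;
  last by move=> [a b] [c d] [-> ->].
apply/eqP; rewrite addr_eq0 -sumrN; apply/eqP/eq_big => [[j l]|[j l] _] /=.
  by case: ltngtP.
exact: TN.
Qed.

Lemma rdet_der (D : R -> R) h :
  {morph D : x y / x + y} -> (forall x y, D (x * y) = D x * y + x * D y) ->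
  D (rdet h) = \sum_i rdet (set_at i (map_mx D (h i)) h).
Proof.
move=> DD DM.
have D0 : D 0 = 0 by apply: (addrI (D 0)); rewrite -DD !addr0.
have DN x : D (- x) = - D x by apply: (addrI (D x)); rewrite -DD !subrr.
have D1 : D 1 = 0.
  by apply: (addrI (D 1)); rewrite addr0; have := DM 1 1; rewrite !mulr1 mul1r.
have Dprod (F : 'I_m -> R) (r : seq 'I_m) : uniq r ->
    D (\prod_(i <- r) F i) =
    \sum_(i <- r) \prod_(k <- r) (if k == i then D (F k) else F k).
  elim: r => [|a r IH] /=; first by rewrite !big_nil D1.
  move=> /andP[ar ur]; rewrite !big_cons DM IH // eqxx; congr (_ * _ + _).
    apply: eq_big_seq => k kr.
    by case: eqP => // ka; rewrite -ka kr in ar.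
  rewrite mulr_sumr; apply: eq_big_seq => i ir; rewrite big_cons.
  by case: eqP => // ai; rewrite ai ir in ar.
rewrite /rdet /determinant (big_morph D DD D0).
rewrite exchange_big /=; apply: eq_bigr => s _.
have Dsign (b : bool) x : D ((-1) ^+ b * x) = (-1) ^+ b * D x.
  by case: b; rewrite ?expr1 ?expr0 ?mul1r // !mulN1r DN.
rewrite Dsign -mulr_sumr Dprod ?index_enum_uniq //; congr (_ * _).
apply: eq_bigr => i _; apply: eq_bigr => k _; rewrite !mxE ffunE.
by case: eqP => [->|//]; rewrite !mxE.
Qed.

End RowDeterminants.

Section QuadraticFormNLie.
Variables (K : fieldType) (n : nat) (f : {mpoly K[n.+1]}).
Implicit Types (u v : {ffun 'I_n -> 'rV[K]_n.+1}).

(* df/dx_i evaluated at (e_1, ..., e_(n+1)): df/dx_i is a linear form when f is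
   a quadratic form, and 'rV[K]_n.+1 is the space with basis e_j = delta_mx 0 j. *)
Definition diff_at_basis (i : 'I_n.+1) : 'rV[K]_n.+1 :=
  \row_j (f^`M(i))@_(U_(j)).

(* The multilinear extension of the multiplication table
   [e_1, .., e_i omitted, .., e_(n+1)] = (-1)^(n-i+1) df/dx_i(e_1, .., e_(n+1)):
   the coefficient of the i-th entry of the table is the minor of the coordinate
   matrix of u with column i removed.  With i counted from 0 the sign is
   (-1)^(n-i) = (-1)^(n+i).  See [Lform_br_basis]. *)
Definition Lform_br u : 'rV[K]_n.+1 :=
  \sum_(i < n.+1)
    ((-1) ^+ (n + i) * \det (col' i (\matrix_k u k))) *: diff_at_basis i.

Lemma Lform_br_basis (i : 'I_n.+1) :
  Lform_br [ffun k : 'I_n => delta_mx 0 (lift i k)] =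
  (-1) ^+ (n - i) *: diff_at_basis i.
Proof.
rewrite /Lform_br (bigD1 i) //= big1 ?addr0 => [|j ji].
  set A := col' _ _; have -> : A = 1%:M.
    apply/matrixP => k l; rewrite !mxE ffunE !mxE /= (inj_eq lift_inj).
    by rewrite eq_sym.
  rewrite det1 mulr1 -signr_odd oddD -oddB ?signr_odd //.
  by rewrite -ltnS ltn_ord.
set A := col' _ _; suff -> : \det A = 0 by rewrite mulr0 scale0r.
have [k jk] : exists k, j = lift i k by case: (unliftP i j) ji => [k|] ->; [exists k|rewrite eqxx].
rewrite (expand_det_row _ k) big1 // => l _; rewrite !mxE ffunE !mxE -jk /=.
by rewrite eq_sym (negPf (neq_lift _ _)) mul0r.
Qed.

Lemma Lform_brE u :
  Lform_br u = \sum_i rdet (stack u (delta_mx 0 i)) *: diff_at_basis i.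
Proof.
apply: eq_bigr => i _; congr (_ *: _).
rewrite (stack_setmax _ _ 0) rdet_expand (bigD1 i) //= big1 => [|j ji].
  rewrite !mxE !eqxx addr0 mul1r /cofactor; congr (_ * \det _).
  by apply/matrixP => k l; rewrite !mxE stack_lift.
by rewrite mxE eqxx (negPf ji) mul0r.
Qed.

Let H : 'M[K]_n.+1 := \matrix_i diff_at_basis i.

Let Hsym : H^T = H.
Proof.
apply/matrixP => i j; rewrite !mxE !mcoeff_mderiv addmC !mnm1E.
by rewrite eq_sym.
Qed.

Let brH u : Lform_br u = (\row_i rdet (stack u (delta_mx 0 i))) *m H.
Proof.
rewrite Lform_brE mulmx_sum_row; apply: eq_bigr => i _.
by rewrite mxE rowK.
Qed.

Lemma Lform_multilinear : multilinear *:%R Lform_br.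
Proof.
move=> u i a x y; rewrite !Lform_brE scaler_sumr -big_split /=.
apply: eq_bigr => j _.
by rewrite !stack_set rdet_lin scalerDl scalerA.
Qed.

Lemma Lform_skew : skew_symmetric Lform_br.
Proof.
move=> u s; rewrite !Lform_brE; transitivity
  ((-1) ^+ odd_perm s *: \sum_i rdet (stack u (delta_mx 0 i)) *: diff_at_basis i).
  rewrite scaler_sumr; apply: eq_bigr => j _.
  by rewrite stack_perm rdet_perm odd_lift_perm addbb scalerA.
by case: (odd_perm s); rewrite ?expr1 ?expr0 ?scaleN1r ?scale1r.
Qed.

Lemma Lform_filippov : filippov_identity Lform_br.
Proof.
move=> u v i0 _; set k0 := lift ord_max i0.
have k0m : k0 != ord_max by rewrite eq_sym neq_lift.
pose A : 'M[K]_n.+1 := \matrix_(l, j)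
  rdet (set_at k0 (delta_mx 0 l) (stack v (delta_mx 0 j))).
pose N := A *m H.
have DE x : Lform_br (set_at i0 x v) = x *m N.
  rewrite brH mulmxA; congr (_ *m _); apply/rowP => j; rewrite !mxE.
  rewrite stack_set rdet_row; apply: eq_bigr => l _; by rewrite !mxE.
have AT : A^T = - A.
  apply/matrixP => l j; rewrite !mxE.
  rewrite (stack_setmax v (delta_mx 0 l) 0) (stack_setmax v (delta_mx 0 j) 0).
by rewrite rdet_swap.
have NT : N^T = - (H *m A) by rewrite trmx_mul Hsym AT mulmxN.
have trN : \tr N = 0.
  rewrite /N mxtrace_mulC /mxtrace.
  rewrite -[RHS](@rdet_sym0 _ _ (stack v 0) k0 ord_max H k0m Hsym).
  under eq_bigr => j _ do rewrite mxE.
  rewrite exchange_big; apply: eq_bigr => j _; apply: eq_bigr => l _.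
  rewrite -[in LHS]Hsym [H^T _ _]mxE; congr (_ * _).
  by rewrite mxE (stack_setmax v _ 0).
have step j : \sum_(i < n) rdet (stack (set_at i (u i *m N) u) (delta_mx 0 j)) =
    - rdet (stack u (delta_mx 0 j *m N)).
  have := rdet_trace (stack u (delta_mx 0 j)) N.
  rewrite trN mul0r (bigD1_ord ord_max) //= stack_max -stack_setmax.
  move/eqP; rewrite addrC addr_eq0 => /eqP <-; apply: eq_bigr => i _.
  by rewrite stack_set stack_lift.
rewrite DE; under eq_bigr => i _ do rewrite DE Lform_brE.
rewrite exchange_big /=; under eq_bigr => j _ do rewrite -scaler_suml step.
pose w : 'rV[K]_n.+1 := \row_l rdet (stack u (delta_mx 0 l)).
transitivity ((- (w *m N^T)) *m H).
  by rewrite NT mulmxN opprK brH -/w /N !mulmxA.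
rewrite mulmx_sum_row; apply: eq_bigr => j _; rewrite rowK; congr (_ *: _).
rewrite mxE [(w *m _) _ _]mxE; congr (- _).
rewrite (stack_setmax _ _ 0) rdet_row; apply: eq_bigr => l _.
by rewrite -stack_setmax mulrC -rowE [w _ _]mxE [N^T _ _]mxE [row _ _ _ _]mxE.
Qed.

Definition Lform : nLieAlgebra K n :=
  NLieAlgebra Lform_multilinear Lform_skew Lform_filippov.

End QuadraticFormNLie.

Section JacobianBracket.
Variables (K : fieldType) (n : nat) (f : {mpoly K[n.+1]}).
Local Notation R := {mpoly K[n.+1]}.
Implicit Types (g u v : {ffun 'I_n -> R}) (h : {ffun 'I_n.+1 -> R}).

Definition jacobian h : R := \det (\matrix_(i, j) (h i)^`M(j)).

(* {g_1, ..., g_n} = J(g_1, ..., g_n, f) *)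
Definition jacobian_br g : R := jacobian (stack g f).

Let grad (p : R) : 'rV[R]_n.+1 := \row_j p^`M(j).
Let G h : {ffun 'I_n.+1 -> 'rV[R]_n.+1} := [ffun i => grad (h i)].

Let jacE h : jacobian h = rdet (G h).
Proof. by congr (\det _); apply/matrixP => i j; rewrite !mxE ffunE mxE. Qed.

Let Gset i x h : G (set_at i x h) = set_at i (grad x) (G h).
Proof. by apply/ffunP => j; rewrite !ffunE; case: eqP. Qed.

Lemma jacobian_multilinear : multilinear (fun a p => a%:MP * p) jacobian_br.
Proof.
move=> u i a x y; rewrite /jacobian_br !jacE !stack_set !Gset -rdet_lin.
congr (rdet (set_at _ _ _)); apply/rowP => j.
by rewrite !mxE mderivD mderiv_mulC.
Qed.

Lemma jacobian_leibniz u i x y :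
  jacobian_br (set_at i (x * y) u) =
  x * jacobian_br (set_at i y u) + jacobian_br (set_at i x u) * y.
Proof.
rewrite /jacobian_br !jacE !stack_set !Gset.
have -> : grad (x * y) = x *: grad y + (y *: grad x + 0).
  apply/rowP => j; rewrite !mxE mderivM addr0 addrC; congr (_ + _).
  exact: mulrC.
rewrite rdet_lin; congr (_ + _); rewrite addr0 mulrC.
have := rdet_lin (G (stack u f)) (lift ord_max i) y (grad x) 0.
rewrite addr0 => ->; rewrite [X in _ + X](_ : _ = 0) ?addr0 //.
by rewrite rdet_row big1 // => j _; rewrite mxE mul0r.
Qed.

Lemma jacobian_skew : skew_symmetric jacobian_br.
Proof.
move=> u s; rewrite /jacobian_br !jacE stack_perm.
have -> : G [ffun i => stack u f (lift_perm ord_max ord_max s i)] =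
    [ffun i => G (stack u f) (lift_perm ord_max ord_max s i)].
  by apply/ffunP => i; rewrite !ffunE.
rewrite rdet_perm odd_lift_perm addbb /=.
by case: (odd_perm s); rewrite ?expr1 ?expr0 ?mulN1r ?mul1r.
Qed.

Lemma jacobian_filippov : filippov_identity jacobian_br.
Proof.
move=> u v i0 _; set k0 := lift ord_max i0.
have k0m : k0 != ord_max by rewrite eq_sym neq_lift.
set W := G (stack v f).
pose a j := rdet (set_at k0 (delta_mx 0 j) W).
pose D x := jacobian_br (set_at i0 x v).
have DE x : D x = \sum_j x^`M(j) * a j.
  rewrite /D /jacobian_br jacE stack_set Gset rdet_row.
  by apply: eq_bigr => j _; rewrite mxE.
have DD : {morph D : x y / x + y}.
  move=> x y; rewrite !DE -big_split; apply: eq_bigr => j _ /=.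
  by rewrite mderivD mulrDl.
have DM x y : D (x * y) = D x * y + x * D y.
  by rewrite /D jacobian_leibniz addrC.
have Df : D f = 0.
  rewrite /D /jacobian_br jacE; apply: (rdet_alt k0m).
  by rewrite !ffunE unlift_none liftK /= ffunE eqxx.
pose N : 'M[R]_n.+1 := \matrix_(k, j) (a k)^`M(j).
have trN : \tr N = 0.
  rewrite /mxtrace.
  under eq_bigr => j _.
    rewrite mxE /a (rdet_der _ (mderivD j) (@mderivM _ _ j)).
    rewrite (bigD1 k0) //= [X in X + _](_ : _ = 0); last first.
      rewrite rdet_row big1 // => l _; rewrite set_atE !mxE.
      by case: (_ && _); rewrite ?mderiv0 ?mderivC ?mul0r.
    rewrite add0r.
    under eq_bigr => k kk0.
      rewrite rdet_row.
      under eq_bigr => l _.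
        rewrite ffunE (negPf kk0) mxE ffunE mxE mderiv_comm set_atC //.
        over.
      over.
    over.
  rewrite exchange_big /= big1 // => k kk0.
  pose Hk : 'M[R]_n.+1 := \matrix_(j, l) (stack v f k)^`M(j)^`M(l).
  have Hs : Hk^T = Hk by apply/matrixP => j l; rewrite !mxE mderiv_comm.
  rewrite -[RHS](@rdet_sym0 _ _ W k0 k Hk _ Hs) 1?eq_sym //.
  by apply: eq_bigr => j _; apply: eq_bigr => l _; rewrite mxE.
have gradD p : map_mx D (grad p) = (-1) *: (grad p *m N) + grad (D p).
  apply/rowP => j; rewrite !mxE DE [in RHS]DE.
  rewrite raddf_sum /= mulN1r addrC -sumrB; apply: eq_bigr => k _.
  by rewrite !mxE mderivM mderiv_comm addrK.
have := rdet_der (G (stack u f)) DD DM.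
rewrite -jacE -/(jacobian_br u) -/(D (jacobian_br u)) => ->.
have tr0 := rdet_trace (G (stack u f)) N; rewrite trN mul0r in tr0.
transitivity (\sum_i rdet (set_at i (grad (D (stack u f i))) (G (stack u f)))).
  transitivity (\sum_i ((-1) * rdet (set_at i (G (stack u f) i *m N) (G (stack u f)))
      + rdet (set_at i (grad (D (stack u f i))) (G (stack u f))))).
    by apply: eq_bigr => i _; rewrite -rdet_lin [G _ i]ffunE gradD.
  by rewrite big_split /= -mulr_sumr tr0 mulr0 add0r.
rewrite (bigD1_ord ord_max) //= stack_max Df [X in X + _](_ : _ = 0); last first.
  by rewrite rdet_row big1 // => j _; rewrite mxE mderiv0 mul0r.
rewrite add0r; apply: eq_bigr => i _.
by rewrite /jacobian_br jacE stack_set Gset stack_lift.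
Qed.

(* The enveloping algebra P(L(f)), with e_i identified with 'X_i; the bracket
   extends that of L(f) by [LformP_extends]. *)
Definition LformP : nLiePoissonAlgebra K n :=
  @NLiePoissonAlgebra K n {mpoly K[n.+1]} (@mpolyC n.+1 K) jacobian_br
    jacobian_multilinear jacobian_skew jacobian_filippov jacobian_leibniz.

Definition linear_form (x : 'rV[K]_n.+1) : R := \sum_j x 0 j *: 'X_j.

Lemma LformP_extends (u : {ffun 'I_n -> 'rV[K]_n.+1}) : f \is 2.-homog ->
  @nlp_br K n LformP [ffun i => linear_form (u i)] =
  linear_form (@nlie_br K n (Lform f) u).
Proof.
move=> hf; have lfZ c x : linear_form (c *: x) = c *: linear_form x.
  rewrite /linear_form scaler_sumr; apply: eq_bigr => j _.
  by rewrite mxE scalerA.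
have lfD : {morph linear_form : x y / x + y}.
  move=> x y; rewrite /linear_form -big_split; apply: eq_bigr => j _ /=.
  by rewrite mxE scalerDl.
have lf0 : linear_form 0 = 0.
  by rewrite /linear_form big1 // => j _; rewrite mxE scale0r.
have grad_lf x : grad (linear_form x) = map_mx (@mpolyC n.+1 K) x.
  apply/rowP => j; rewrite !mxE /linear_form raddf_sum (bigD1 j) //= big1.
    rewrite addr0 linearZ /= mderivX mnm1E eqxx scale1r.
    have -> : (U_(j) - U_(j) = 0 :> 'X_{1.. n.+1})%MM.
      by apply/mnmP => k; rewrite mnmBE subnn mnm0E.
    by rewrite mpolyX0 -mul_mpolyC mulr1.
  move=> i ij; rewrite linearZ /= mderivX mnm1E (negPf ij) scale0r scaler0 //.
have lf_diff i : linear_form (diff_at_basis f i) = f^`M(i).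
  apply/mpolyP => m; rewrite /linear_form raddf_sum /=.
  under eq_bigr => j _ do rewrite mcoeffZ mcoeffX mxE.
  case: (boolP (mdeg m == 1%N)) => [|m1].
    move/mdeg1P => [j /eqP->]; rewrite (bigD1 j) //= eqxx mulr1 big1 ?addr0 //.
    move=> l lj; rewrite (_ : _ == _ = false) ?mulr0 //.
    by apply/negbTE; apply: contra lj => /eqP/mnmP/(_ l);
       rewrite !mnm1E eqxx; case: eqP => [->|].
  rewrite big1 => [|j _].
    rewrite mcoeff_mderiv (dhomog_nemf_coeff hf) ?mul0rn //.
    by change (mdeg (m + U_(i))%MM != 2); rewrite mdegD mdeg1 addn1.
  by rewrite (_ : _ == _ = false) ?mulr0 //; apply: contraNF m1 => /eqP<-; rewrite mdeg1.
rewrite /= /jacobian_br jacE (stack_setmax _ _ 0) Gset rdet_expand.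
rewrite /Lform_br (big_morph linear_form lfD lf0); apply: eq_bigr => j _.
rewrite lfZ lf_diff mxE mulrC -mul_mpolyC; congr (_ * _).
rewrite /cofactor rmorphM rmorphXn rmorphN1 /=; congr (_ * _).
rewrite -det_map_mx; congr (\det _); apply/matrixP => k l.
by rewrite !mxE ffunE stack_lift ffunE grad_lf mxE.
Qed.

Lemma LformP_casimir (lambda : K) (g : {ffun 'I_n -> R}) (i : 'I_n) :
  jacobian_br (set_at i (f - lambda%:MP) g) = 0.
Proof.
rewrite /jacobian_br jacE; apply: (@rdet_alt _ _ _ (lift ord_max i) ord_max).
  by rewrite eq_sym neq_lift.
apply/rowP => j; rewrite !ffunE unlift_none liftK /= ffunE eqxx !mxE.
by rewrite mderivB mderivC subr0.
Qed.

End JacobianBracket.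

Section PrincipalQuotient.
Variables (R : comPzRingType) (c : R).

(* The ideal (c), as a boolean predicate so that the library's quotients apply;
   membership is decided classically. *)
Definition principal : {pred R} := fun x => `[< exists y, x = y * c >].

Lemma principalP x : reflect (exists y, x = y * c) (x \in principal).
Proof. exact: asboolP. Qed.

Fact principal_zmod_closed : zmod_closed principal.
Proof.
split=> [|x y /principalP[a ->] /principalP[b ->]]; apply/principalP.
  by exists 0; rewrite mul0r.
by exists (a - b); rewrite mulrBl.
Qed.
HB.instance Definition _ := GRing.isZmodClosed.Build R principal
  principal_zmod_closed.

Lemma principalM x y : y \in principal -> x * y \in principal.
Proof.
by move=> /principalP[a ->]; apply/principalP; exists (x * a); rewrite mulrA.
Qed.

Definition pquot : Type := Quotient.quot principal.
HB.instance Definition _ := GRing.Zmodule.on pquot.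

Definition to_pquot (x : R) : pquot := \pi_(Quotient.quot principal)%qT x.
Definition of_pquot (x : pquot) : R :=
  repr (x : Quotient.quot principal).

Lemma of_pquotK : cancel of_pquot to_pquot.
Proof. exact: reprK. Qed.

Lemma eq_pquot x y : to_pquot x = to_pquot y <-> x - y \in principal.
Proof.
rewrite (Quotient.idealrBE principal); split=> [/eqP //|/eqP //].
Qed.

Lemma to_pquot_repr x : of_pquot (to_pquot x) - x \in principal.
Proof. by apply/eq_pquot; rewrite of_pquotK. Qed.

Fact to_pquot_zmod : zmod_morphism to_pquot.
Proof. exact: (raddfB (\pi_(Quotient.quot principal)%qT)). Qed.
HB.instance Definition _ := GRing.isZmodMorphism.Build R pquot to_pquot
  to_pquot_zmod.

Definition pquot_one : pquot := to_pquot 1.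
Definition pquot_mul (x y : pquot) : pquot := to_pquot (of_pquot x * of_pquot y).

Lemma to_pquotM : {morph to_pquot : x y / x * y >-> pquot_mul x y}.
Proof.
move=> x y; apply/eqP; rewrite eq_sym; apply/eqP/eq_pquot.
have -> : forall x' y', x' * y' - x * y = x' * (y' - y) + y * (x' - x).
  by move=> x' y'; rewrite !mulrBr [y * x']mulrC [y * x]mulrC addrA subrK.
by rewrite rpredD // principalM // to_pquot_repr.
Qed.

Fact pquot_mulA : associative pquot_mul.
Proof.
move=> x y z; rewrite -(of_pquotK x) -(of_pquotK y) -(of_pquotK z).
by rewrite -!to_pquotM mulrA.
Qed.
Fact pquot_mulC : commutative pquot_mul.
Proof. by move=> x y; rewrite /pquot_mul mulrC. Qed.
Fact pquot_mul1 : left_id pquot_one pquot_mul.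
Proof. by move=> x; rewrite -(of_pquotK x) -to_pquotM mul1r. Qed.
Fact pquot_mulDl : left_distributive pquot_mul +%R.
Proof.
move=> x y z; rewrite -(of_pquotK x) -(of_pquotK y) -(of_pquotK z).
by rewrite -raddfD -!to_pquotM mulrDl raddfD.
Qed.
HB.instance Definition _ := GRing.Zmodule_isComPzRing.Build pquot
  pquot_mulA pquot_mulC pquot_mul1 pquot_mulDl.

Fact to_pquot_monoid : monoid_morphism to_pquot.
Proof. by split=> //; exact: to_pquotM. Qed.
HB.instance Definition _ := GRing.isMonoidMorphism.Build R pquot to_pquot
  to_pquot_monoid.

End PrincipalQuotient.

Section PoissonQuotient.
Variables (K : fieldType) (n : nat) (P : nLiePoissonAlgebra K n) (c : P).
Hypothesis c_casimir : forall (g : {ffun 'I_n -> P}) (i : 'I_n),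
  nlp_br (set_at i c g) = 0.
Local Notation Q := (pquot c).
Local Notation pi := (@to_pquot P c).
Implicit Types (g : {ffun 'I_n -> P}).

Let lft (u : {ffun 'I_n -> Q}) : {ffun 'I_n -> P} := [ffun i => of_pquot (u i)].
Let proj (u : {ffun 'I_n -> P}) : {ffun 'I_n -> Q} := [ffun i => pi (u i)].

(* The induced bracket {g_1 + (c), ..., g_n + (c)} = {g_1, ..., g_n} + (c),
   computed on representatives; see [pquot_brE]. *)
Definition pquot_br (u : {ffun 'I_n -> Q}) : Q :=
  pi (nlp_br [ffun i => of_pquot (u i)]).

Let brD g i x y : nlp_br (set_at i (x + y) g) =
  nlp_br (set_at i x g) + nlp_br (set_at i y g).
Proof.
by have := nlp_multilinear g i 1 x y; rewrite rmorph1 !mul1r.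
Qed.

Let br_one g i x y : pi x = pi y ->
  pi (nlp_br (set_at i x g)) = pi (nlp_br (set_at i y g)).
Proof.
move=> /eq_pquot/principalP[a xy].
rewrite -[x](subrK y) xy brD nlp_leibniz c_casimir mulr0 add0r rmorphD.
rewrite [X in X + _](_ : _ = 0) ?add0r //.
by rewrite -(rmorph0 pi); apply/eq_pquot/principalP; rewrite subr0; eexists.
Qed.

Lemma pquot_brE g : pi (nlp_br g) = pquot_br [ffun i => pi (g i)].
Proof.
rewrite /pquot_br; set g' := [ffun i => of_pquot _].
have eqg i : pi (g i) = pi (g' i) by rewrite !ffunE of_pquotK.
pose h k := [ffun i : 'I_n => if (i < k)%N then g' i else g i].
have -> : g' = h n by apply/ffunP => i; rewrite [RHS]ffunE ltn_ord.
have {1}-> : g = h 0%N by apply/ffunP => i; rewrite [RHS]ffunE.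
suff H k : (k <= n)%N -> pi (nlp_br (h 0%N)) = pi (nlp_br (h k)) by exact: H.
elim: k => // k IH kn; rewrite IH 1?ltnW //.
have hS x : set_at (Ordinal kn) x (h k.+1) = set_at (Ordinal kn) x (h k).
  apply/ffunP => i; rewrite !ffunE ltnS leq_eqVlt.
  by case: eqP => //= /eqP; rewrite -val_eqE /= => /negPf->.
rewrite -[in LHS](set_at_id (Ordinal kn) (h k)).
rewrite -[in RHS](set_at_id (Ordinal kn) (h k.+1)) hS.
by apply: br_one; rewrite [h k _]ffunE [h k.+1 _]ffunE /= ltnn ltnSn eqg.
Qed.

Let lftK u : proj (lft u) = u.
Proof. by apply/ffunP => i; rewrite !ffunE of_pquotK. Qed.

Let proj_set i x g : proj (set_at i x g) = set_at i (pi x) (proj g).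
Proof. by apply/ffunP => j; rewrite !ffunE; case: eqP. Qed.

Let brE g : pquot_br (proj g) = pi (nlp_br g).
Proof. by rewrite pquot_brE. Qed.

Definition pquot_scalar : K -> Q := pi \o nlp_scalar P.
HB.instance Definition _ := GRing.RMorphism.on pquot_scalar.

Lemma pquot_multilinear : multilinear (fun a x => pquot_scalar a * x) pquot_br.
Proof.
move=> u i a x y; rewrite -(lftK u) -(of_pquotK x) -(of_pquotK y).
set x' := of_pquot x; set y' := of_pquot y.
have -> : pquot_scalar a * pi x' + pi y' = pi (nlp_scalar P a * x' + y').
  by rewrite rmorphD rmorphM.
by rewrite -!proj_set !brE (nlp_multilinear (lft u)) rmorphD rmorphM.
Qed.

Lemma pquot_skew : skew_symmetric pquot_br.
Proof.
move=> u s; rewrite -(lftK u).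
have -> : [ffun i => proj (lft u) (s i)] = proj [ffun i => lft u (s i)].
  by apply/ffunP => i; rewrite !ffunE.
by rewrite !brE nlp_skew; case: (odd_perm s); rewrite ?rmorphN.
Qed.

Lemma pquot_filippov : filippov_identity pquot_br.
Proof.
move=> u v i0 hi0; rewrite -(lftK u) -(lftK v) brE -proj_set brE.
rewrite nlp_filippov // rmorph_sum; apply: eq_bigr => i _.
have -> : proj (lft u) i = pi (lft u i) by rewrite ffunE.
by rewrite -(proj_set i0) brE -(proj_set i) brE.
Qed.

Lemma pquot_leibniz (u : {ffun 'I_n -> Q}) (i : 'I_n) (x y : Q) :
  pquot_br (set_at i (x * y) u) =
  x * pquot_br (set_at i y u) + pquot_br (set_at i x u) * y.
Proof.
rewrite -(lftK u) -(of_pquotK x) -(of_pquotK y) -rmorphM -!proj_set !brE.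
by rewrite nlp_leibniz rmorphD !rmorphM.
Qed.

(* P / (c) for a Casimir element c *)
Definition nlp_quotient : nLiePoissonAlgebra K n :=
  NLiePoissonAlgebra pquot_multilinear pquot_skew pquot_filippov pquot_leibniz.

End PoissonQuotient.

(* P(L(f)) / (f - lambda) *)
Definition LformP_mod (K : fieldType) (n : nat) (f : {mpoly K[n.+1]})
    (lambda : K) : nLiePoissonAlgebra K n :=
  @nlp_quotient K n (LformP f) (f - lambda%:MP) (LformP_casimir f lambda).

(* Main.v *)
Require Import Defs.
From mathcomp Require Import all_boot all_order all_fingroup all_algebra.
From mathcomp Require Import mpoly ring zify.

Set Implicit Arguments.
Unset Strict Implicit.
Unset Printing Implicit Defensive.

Import GRing.Theory.
Local Open Scope ring_scope.

(**
The statement is about the affine quadric f = lambda.  Write f_i for the partial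
derivatives of f.  Simplicity of L(f) is used only through the invertibility of
the Hessian H of f: all brackets of L(f) lie in the row space of H, which is
therefore an ideal, and a nonzero one since the bracket is nonzero
([simple_nondegenerate]).

Bracketing h with n - 1 of the coordinates gives, up to sign, the rotation
D_ij h = f_i (dh/dx_j) - f_j (dh/dx_i), a derivation that kills f
([jacobian_br_rotation]).  Everything rests on two consequences of these
derivations.

- Invariants.  A form q of degree e with D_ij q = 0 for all i, j is a multiple of
  f ^ (e/2), and is 0 if e is odd ([rotation_invariant]).  Contracting the
  relations f_i (dq/dx_j) = f_j (dq/dx_i) with H^-1 and one more derivative gives
  (n + e - 1) dq/dx_j = f_j (Lap q), where Lap is the Laplacian of the dual form;
  Euler's identity turns this into e q = 2 f q' for q' = Lap q / (n + e - 1), and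
  q' is again invariant.

- Descent.  By Euler's identity, the sum of the x_i D_ij h is
  2 f (dh/dx_j) - f_j (E h), with E the Euler operator.  If an ideal J contains
  f - lambda and is stable under all D_ij, then it contains
  2 lambda (dh/dx_j) - f_j (E h) for every h in J.  When h is a form of degree d,
  E h = d h lies in J, so J contains all the partial derivatives of h; hence J
  contains 1 as soon as it contains a nonzero form ([invariant_ideal_homog]).

Since lambda is invertible, powers of f / lambda adjust degrees modulo f - lambda:
every polynomial is congruent to p + q with p a form of even degree and q a form
of the next degree ([level_ideal_homogenize]), and such a sum lies in (f - lambda)
only if p = q = 0 ([level_ideal_pair]).

Centre: if p + q is central modulo f - lambda, then D_ij p + D_ij q is in
(f - lambda), so both terms vanish; hence q = 0 and p is a multiple of a power of
f, which is congruent to a constant ([rotation_center]).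

Simplicity: let J be the preimage of an ideal of the quotient and let p + q in J
be nonzero, with p and q forms of degrees of different parity.  The descent
formula for p + q trades p for its partial derivatives at the cost of raising the
degree of q; it ends when p is constant.  Then D_ij (p + q) = D_ij q are forms in
J, and they are not all 0 because q has odd degree ([invariant_ideal_pair]).
*)

(** * Forms: Euler's identity and homogeneous components *)

Lemma pchar0_natf_neq0 (K : fieldType) k : [pchar K] =i pred0 -> (0 < k)%N ->
  k%:R != 0 :> K.
Proof. by move=> /pcharf0P -> ; rewrite lt0n. Qed.

Section Homogeneous.
Variables (K : fieldType) (n : nat).
Implicit Types (p q : {mpoly K[n]}) (i j : 'I_n).

Lemma dhomog_mderiv d p i : p \is d.-homog -> p^`M(i) \is d.-1.-homog.
Proof.
move=> /dhomogP hp; apply/dhomogP => m.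
rewrite mcoeff_msupp mcoeff_mderiv => nz.
have /hp : (m + U_(i))%MM \in msupp p.
  by rewrite mcoeff_msupp; apply: contraNneq nz => ->; rewrite mul0rn.
by move=> <- /=; rewrite [X in X.-1](mdegD m) mdeg1 addn1.
Qed.

Lemma dhomog0_const p : p \is 0.-homog -> p = (p@_0)%:MP.
Proof.
move=> hp; apply/mpolyP => m; rewrite mcoeffC.
case: eqP => [->|/eqP m0]; first by rewrite mulr1.
by rewrite mulr0 (dhomog_nemf_coeff hp) //= mdeg_eq0.
Qed.

Lemma mderiv_dhomog0 p i : p \is 0.-homog -> p^`M(i) = 0.
Proof. by move/dhomog0_const->; rewrite mderivC. Qed.

Lemma dhomog1_linear p : p \is 1.-homog -> p = \sum_j p@_(U_(j)) *: 'X_j.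
Proof.
move=> hp; apply/mpolyP => m; rewrite raddf_sum /=.
under eq_bigr => j _ do rewrite mcoeffZ mcoeffX.
have [|m1] := boolP (mdeg m == 1%N).
  move/mdeg1P => [j /eqP->]; rewrite (bigD1 j) //= eqxx mulr1 big1 ?addr0 //.
  move=> l lj; rewrite (_ : _ == _ = false) ?mulr0 //.
  by apply/negbTE; apply: contra lj => /eqP/mnmP/(_ l);
     rewrite !mnm1E eqxx; case: eqP => [->|].
rewrite (dhomog_nemf_coeff hp) // big1 // => j _.
rewrite (_ : _ == _ = false) ?mulr0 //.
by apply: contraNF m1 => /eqP<-; rewrite mdeg1.
Qed.

Lemma euler d p : p \is d.-homog -> \sum_i 'X_i * p^`M(i) = d%:R *: p.
Proof.
move=> /dhomogP hp.
have dE (g : {mpoly K[n]} -> {mpoly K[n]}) : {morph g : x y / x + y} -> g 0 = 0 ->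
    g p = \sum_(m <- msupp p) g (p@_m *: 'X_[m]).
  by move=> gD g0; rewrite {1}[p]mpolyE (big_morph g gD g0).
have -> : \sum_i 'X_i * p^`M(i) =
    \sum_(m <- msupp p) \sum_i 'X_i * (p@_m *: 'X_[m])^`M(i).
  rewrite exchange_big /=; apply: eq_bigr => i _.
  apply: (dE (fun q => 'X_i * q^`M(i))) => [x y|]; last by rewrite mderiv0 mulr0.
  by rewrite mderivD mulrDr.
rewrite [in RHS](mpolyE p) scaler_sumr; apply: eq_big_seq => m /hp /= mE.
rewrite -mE mdegE natr_sum scaler_suml; apply: eq_bigr => i _.
rewrite mderivZ mderivX; have [mi0|mi] := eqVneq (m i) 0%N.
  by rewrite mi0 !scale0r scaler0 mulr0.
rewrite -!scalerAr !scalerA mulrC; congr (_ *: _).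
rewrite -mpolyXD; congr 'X_[_].
by rewrite addmC submK // lep1mP.
Qed.

Lemma mderiv_eq0_dhomog d p : [pchar K] =i pred0 -> (0 < d)%N ->
  p \is d.-homog -> (forall i, p^`M(i) = 0) -> p = 0.
Proof.
move=> ch0 d0 hp dp; have := euler hp.
rewrite big1 => [|i _]; last by rewrite dp mulr0.
by move/esym/eqP; rewrite scaler_eq0 (negPf (pchar0_natf_neq0 ch0 d0)) => /eqP.
Qed.

Lemma pihomog_eq0 k p : (mmeasure mdeg p <= k)%N -> pihomog mdeg k p = 0.
Proof.
move=> le; rewrite (pihomog_partitionE le) raddf_sum big1 // => i _ /=.
by rewrite (@pihomog_ne0 _ _ _ i) ?pihomogP // neq_ltn ltn_ord.
Qed.

Lemma pihomogM d k p q : q \is d.-homog ->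
  pihomog mdeg k (p * q) =
  if (d <= k)%N then pihomog mdeg (k - d) p * q else 0.
Proof.
move=> hq; rewrite {1}(pihomog_partitionE (mf := mdeg) (leqnn (mmeasure mdeg p))).
set s := mmeasure _ p; rewrite mulr_suml raddf_sum /=.
have hM (i : nat) : pihomog mdeg k (pihomog mdeg i p * q) =
    if (i + d == k)%N then pihomog mdeg i p * q else 0.
  have h := dhomogM (pihomogP mdeg i p) hq.
  by case: eqP => [<-|/eqP ne]; [rewrite pihomog_dE | rewrite (pihomog_ne0 ne)].
under eq_bigr => i _ do rewrite hM.
have [dk|kd] := leqP d k; last first.
  by rewrite big1 // => i _; rewrite gtn_eqF // (leq_trans kd) ?leq_addl.
have [lt|ge] := ltnP (k - d) s.
  rewrite (bigD1 (Ordinal lt)) //= subnK // eqxx big1 ?addr0 // => i ne.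
  case: eqP => // e; case/eqP: ne; apply/val_inj.
  by rewrite /= -e addnK.
rewrite big1 => [|i _]; last first.
  case: eqP => // e; move: (ltn_ord i).
  by rewrite ltnNge -e addnK in ge *; rewrite ge.
by rewrite pihomog_eq0 // mul0r.
Qed.

End Homogeneous.

(** * Rotations and their invariants *)

Definition hessian (K : fieldType) n (f : {mpoly K[n.+1]}) : 'M[K]_n.+1 :=
  \matrix_i diff_at_basis f i.

Section Rotations.
Variables (K : fieldType) (n : nat) (f : {mpoly K[n.+1]}).
Hypothesis ch0 : [pchar K] =i pred0.
Hypothesis n_gt0 : (0 < n)%N.
Hypothesis f_quad : f \is 2.-homog.
Hypothesis f_nondeg : hessian f \in unitmx.

Local Notation R := {mpoly K[n.+1]}.
Local Notation H := (hessian f).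
Local Notation G := (invmx H).
Implicit Types (p q h : R) (i j k : 'I_n.+1).

(** The vector field f_i d_j - f_j d_i; for f the sum of the x_i ^ 2 it is twice
    the infinitesimal rotation in the plane (i, j). *)
Definition rotation i j h : R := f^`M(i) * h^`M(j) - f^`M(j) * h^`M(i).

Lemma rotationD i j : {morph rotation i j : p q / p + q}.
Proof. by move=> p q; rewrite /rotation !mderivD !mulrDr opprD addrACA. Qed.

Lemma rotationM i j p q :
  rotation i j (p * q) = rotation i j p * q + p * rotation i j q.
Proof.
by rewrite /rotation !mderivM; ring. Qed.

Lemma rotation_form i j : rotation i j f = 0.
Proof. by rewrite /rotation mulrC subrr. Qed.

Lemma rotationC i j c : rotation i j c%:MP = 0.
Proof. by rewrite /rotation !mderivC !mulr0 subrr. Qed.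

Lemma dhomog_grad i : f^`M(i) \is 1.-homog.
Proof. exact: (dhomog_mderiv i f_quad). Qed.

Lemma mderiv_grad i k : f^`M(i)^`M(k) = (H i k)%:MP.
Proof.
rewrite [LHS]dhomog0_const ?(dhomog_mderiv k (dhomog_grad i)) //.
by rewrite !mxE mcoeff_mderiv mnm0E mulr1n add0m.
Qed.

(** f_i is the i-th entry of H x, so H^-1 recovers the coordinates from the
    gradient. *)
Lemma invhessian_grad k : \sum_i (G k i)%:MP * f^`M(i) = 'X_k.
Proof.
under eq_bigr => i _.
  rewrite mul_mpolyC (dhomog1_linear (dhomog_grad i)) scaler_sumr.
  under eq_bigr => j _ do rewrite scalerA.
  over.
have GH j : \sum_i G k i * (f^`M(i))@_U_(j) = (k == j)%:R.
  have : (G *m H) k j = (k == j)%:R by rewrite mulVmx // mxE.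
  by rewrite mxE => <-; apply: eq_bigr => i _; rewrite !mxE.
rewrite exchange_big /=; under eq_bigr => j _ do rewrite -scaler_suml GH.
rewrite (bigD1 k) //= eqxx scale1r big1 ?addr0 // => j jk.
by rewrite eq_sym (negPf jk) scale0r.
Qed.

Lemma form_neq0 : f != 0.
Proof.
apply: contraTneq f_nondeg => f0.
have -> : H = 0.
  by apply/matrixP => i j; rewrite !mxE f0 mderiv0 mcoeff0.
by rewrite unitmxE det0 unitr0.
Qed.

Lemma dhomog_rotation d i j p : p \is d.-homog -> rotation i j p \is d.-homog.
Proof.
case: d => [|d] hp.
  by rewrite /rotation !(mderiv_dhomog0 _ hp) !mulr0 subrr dhomog0.
have h k l : f^`M(k) * p^`M(l) \is d.+1.-homog.
  exact: (dhomogM (dhomog_grad k) (dhomog_mderiv l hp)).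
exact: rpredB (h i j) (h j i).
Qed.

(** The second-order operator given by the quadratic form dual to f. *)
Definition laplacian q : R := \sum_i \sum_k (G k i)%:MP * q^`M(i)^`M(k).

Lemma dhomog_laplacian d p : p \is d.-homog -> laplacian p \is d.-2.-homog.
Proof.
move=> hp; apply: rpred_sum => i _; apply: rpred_sum => k _.
by rewrite mul_mpolyC; apply/dhomogZ/dhomog_mderiv/dhomog_mderiv.
Qed.

(** Applying the sum of the (H^-1)_ki d_k to both sides of
    f_i (dq/dx_j) = f_j (dq/dx_i) produces on the left the trace n + 1 and the
    Euler operator on dq/dx_j, on the right dq/dx_j and f_j times the Laplacian.
    So the gradient of an invariant form is proportional to that of f. *)
Lemma invariant_grad e q j : q \is e.+1.-homog ->
  (forall i, rotation i j q = 0) ->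
  (n + e)%:R *: q^`M(j) = f^`M(j) * laplacian q.
Proof.
move=> hq inv_q.
have sumE : \sum_k \sum_i (G k i)%:MP * (f^`M(i) * q^`M(j))^`M(k) =
            \sum_k \sum_i (G k i)%:MP * (f^`M(j) * q^`M(i))^`M(k).
  apply: eq_bigr => k _; apply: eq_bigr => i _; congr (_ * _^`M(k)).
  by apply/eqP; rewrite -subr_eq0; apply/eqP/inv_q.
have lhs : \sum_k \sum_i (G k i)%:MP * (f^`M(i) * q^`M(j))^`M(k) =
    (n.+1 + e)%:R *: q^`M(j).
  under eq_bigr => k _ do under eq_bigr => i _ do
    rewrite mderivM mulrDr mderiv_grad !mulrA -mpolyCM.
  under eq_bigr => k _ do
    rewrite big_split /= -!mulr_suml invhessian_grad -rmorph_sum.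
  rewrite big_split /= (euler (dhomog_mderiv j hq)) natrD scalerDl; congr (_ + _).
  rewrite -mulr_suml -rmorph_sum /= mul_mpolyC; congr (_ *: _).
  rewrite -(mxtrace1 K n.+1) -(mulVmx f_nondeg); apply: eq_bigr => k _.
  by rewrite mxE.
have rhs : \sum_k \sum_i (G k i)%:MP * (f^`M(j) * q^`M(i))^`M(k) =
    q^`M(j) + f^`M(j) * laplacian q.
  rewrite exchange_big /=.
  under eq_bigr => i _ do under eq_bigr => k _ do
    rewrite mderivM mulrDr mderiv_grad mulrA -mpolyCM.
  under eq_bigr => i _ do rewrite big_split /= -mulr_suml -rmorph_sum /=.
  rewrite big_split /=; congr (_ + _); last first.
    rewrite mulr_sumr; apply: eq_bigr => i _; rewrite mulr_sumr.
    by apply: eq_bigr => k _; rewrite mulrCA.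
  have HG i : \sum_k G k i * H j k = (j == i)%:R.
    have <- : (H *m G) j i = (j == i)%:R by rewrite mulmxV // mxE.
    by rewrite mxE; apply: eq_bigr => k _; rewrite mulrC.
  under eq_bigr => i _ do rewrite HG.
  rewrite (bigD1 j) //= eqxx mpolyC1 mul1r big1 ?addr0 // => i ij.
  by rewrite eq_sym (negPf ij) mpolyC0 mul0r.
move: sumE; rewrite lhs rhs addSn mulrSr scalerDl scale1r addrC.
by move/addrI.
Qed.

(** By [invariant_grad] and Euler's identity, an invariant form of positive degree
    is f times an invariant form of degree smaller by 2; in degree 1 that factor
    is 0.  For n = 0 the linear form x with f = x ^ 2 would be an odd invariant;
    the hypothesis on n makes n + e - 1 nonzero for every degree e > 0. *)
Lemma rotation_invariant e q : q \is e.-homog ->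
  (forall i j, rotation i j q = 0) ->
  exists2 c : K, q = c *: f ^+ e./2 & odd e -> c = 0.
Proof.
elim/ltn_ind: e q => -[|e] IH q hq inv_q.
  by exists q@_0 => //=; rewrite expr0 -mul_mpolyC mulr1 -dhomog0_const.
have ne0 : (n + e)%:R != 0 :> K by rewrite pchar0_natf_neq0 // ltn_addr.
have e0 : e.+1%:R != 0 :> K by rewrite pchar0_natf_neq0.
(* Euler's identity reads e.+1 q = 2 f (laplacian q) / (n + e). *)
pose c0 := (e.+1%:R)^-1 * 2 * (n + e)%:R^-1 : K.
have qE : q = f * (c0 *: laplacian q).
  apply: (@scalerI _ _ e.+1%:R) => //; rewrite -(euler hq).
  apply: (@scalerI _ _ (n + e)%:R) => //; rewrite scaler_sumr.
  under eq_bigr => j _ do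
    rewrite scalerAr (invariant_grad hq (fun i => inv_q i j)) mulrA.
  rewrite -mulr_suml (euler f_quad) -!scalerAr !scalerA -scalerAl; congr (_ *: _).
  rewrite /c0; move: (n + e)%:R (e.+1%:R) ne0 e0 => a b a0 b0.
  by field; rewrite a0 b0.
have hl := dhomog_laplacian hq; rewrite /= in hl.
set q1 := c0 *: laplacian q in qE.
have q1E : q1 = c0 *: laplacian q by [].
have hq1 : q1 \is e.-1.-homog by apply: dhomogZ.
clearbody q1; case: e => [|e] in IH hq ne0 e0 c0 q1 qE q1E hl hq1 *.
  exists 0 => //; rewrite scale0r qE.
  suff -> : q1 = 0 by rewrite mulr0.
  rewrite q1E /laplacian big1 ?scaler0 // => i _; rewrite big1 // => k _.
  by rewrite mderiv_dhomog0 ?mulr0 // (dhomog_mderiv i hq).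
have [||c q1c c0E] := IH e _ q1 hq1; first by rewrite ltnS leqnSn.
  move=> i j; have := inv_q i j; rewrite qE rotationM rotation_form mul0r add0r.
  by move/eqP; rewrite mulf_eq0 (negPf form_neq0) => /eqP.
exists c; last by rewrite /= negbK.
by rewrite qE q1c -scalerAr -exprS.
Qed.

End Rotations.

(** * Polynomials modulo f - lambda *)

Section LevelSet.
Variables (K : fieldType) (n : nat) (f : {mpoly K[n.+1]}) (lambda : K).
Hypothesis f_quad : f \is 2.-homog.
Hypothesis lambda_neq0 : lambda != 0.

Local Notation R := {mpoly K[n.+1]}.
Local Notation level_ideal := (principal (f - lambda%:MP)).
Implicit Types (p q h : R) (i j : 'I_n.+1).

(** f / lambda is congruent to 1, so multiplying by it raises degrees by 2 for
    free. *)
Lemma level_form_exp k : (lambda^-1 *: f) ^+ k - 1 \in level_ideal.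
Proof.
elim: k => [|k IH]; first by rewrite subrr rpred0.
have -> : (lambda^-1 *: f) ^+ k.+1 - 1 =
    ((lambda^-1)%:MP * (lambda^-1 *: f) ^+ k) * (f - lambda%:MP) +
    ((lambda^-1 *: f) ^+ k - 1).
  have l1 : lambda%:MP * (lambda^-1)%:MP = 1 :> R by rewrite -mpolyCM divff.
  by rewrite exprS -!mul_mpolyC; ring: l1.
by rewrite rpredD //; apply/principalP; eexists.
Qed.

(** A monomial keeps its parity when multiplied by a power of f / lambda, so all
    even monomials can be brought to one degree, and all odd ones to the next.
    Even and odd parts cannot be merged; this is why pairs of forms occur below. *)
Lemma level_ideal_homogenize h : exists d p q,
  [/\ p \is d.*2.-homog, q \is d.*2.+1.-homog & h - (p + q) \in level_ideal].
Proof.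
pose d := mmeasure mdeg h; exists d.
suff [p [q []]] : exists p q, [/\ p \is d.*2.-homog, q \is d.*2.+1.-homog &
    h - (p + q) \in level_ideal] by exists p, q.
rewrite {1}(mpolyE h); have : {in msupp h, forall m, (mdeg m <= d)%N}.
  by move=> m mh; apply: ltnW; apply: mmeasure_mnm_lt.
elim: (msupp h) => [|m s IH] hs.
  by exists 0, 0; rewrite !dhomog0 big_nil addr0 subrr rpred0.
have [|p [q [hp hq hpq]]] := IH; first by
  move=> m' m's; apply: hs; rewrite inE m's orbT.
have /hs md : m \in m :: s by rewrite inE eqxx.
pose k := (d - (mdeg m)./2)%N.
pose t := h@_m *: 'X_[m] * (lambda^-1 *: f) ^+ k.
have ht : t \is (mdeg m + 2 * k).-homog.
  apply: dhomogM; first by rewrite dhomogZ // dhomogX.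
  by apply/dhomogMn/dhomogZ.
have tE : h@_m *: 'X_[m] - t \in level_ideal.
  rewrite -[X in X - _]mulr1 -mulrBr -opprB mulrN rpredN principalM //.
  exact: level_form_exp.
have mE := odd_double_half (mdeg m).
rewrite big_cons; case: (odd (mdeg m)) mE => mE.
  exists p, (t + q); split=> //.
    by rewrite rpredD // (_ : d.*2.+1 = (mdeg m + 2 * k)%N) //; rewrite /k; lia.
  by rewrite (addrCA p) opprD addrACA rpredD.
exists (t + p), q; split=> //.
  by rewrite rpredD // (_ : d.*2 = (mdeg m + 2 * k)%N) //; rewrite /k; lia.
by rewrite -(addrA t) opprD addrACA rpredD.
Qed.

Hypothesis f_nondeg : hessian f \in unitmx.

(** The lowest and the highest components of a nonzero y (f - lambda) have degrees
    that differ by at least 2, whereas p + q lives in two adjacent degrees. *)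
Lemma level_ideal_pair d p q : p \is d.-homog -> q \is d.+1.-homog ->
  p + q \in level_ideal -> p = 0 /\ q = 0.
Proof.
move=> hp hq /principalP[y pqE].
pose pi k : R -> R := pihomog mdeg k.
have piE k : pi k (p + q) =
    (if (2 <= k)%N then pi (k - 2)%N y * f else 0) - lambda *: pi k y.
  rewrite pqE mulrBr [y * _%:MP]mulrC mul_mpolyC /pi raddfB /= linearZ /=.
  by rewrite (pihomogM _ _ f_quad).
have pi0 k : k != d -> k != d.+1 -> pi k (p + q) = 0.
  rewrite ![k == _]eq_sym => kd kd1.
  by rewrite /pi raddfD /= (pihomog_ne0 kd hp) (pihomog_ne0 kd1 hq) addr0.
(* Below degree d the components of y vanish by induction upwards, *)
have low k : (k < d)%N -> pi k y = 0.
  elim/ltn_ind: k => k IH kd; have := piE k.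
  rewrite pi0; [|lia|lia]; case: ifP => k2.
    rewrite IH ?mul0r ?sub0r; [|lia|lia].
    by move/esym/eqP; rewrite oppr_eq0 scaler_eq0 (negPf lambda_neq0) => /eqP.
  by move/esym/eqP; rewrite sub0r oppr_eq0 scaler_eq0 (negPf lambda_neq0) => /eqP.
(* and from degree d on by induction downwards, from the degree of y. *)
have high s k : (d <= k)%N -> (mmeasure mdeg y <= k + s)%N -> pi k y = 0.
  elim: s k => [|s IH] k dk; first by rewrite addn0; apply: pihomog_eq0.
  move=> hs; have := piE k.+2; rewrite pi0; [|lia|lia].
  rewrite /= subn2 /= (IH k.+2) ?scaler0 ?subr0; [|lia|lia].
  by move/esym/eqP; rewrite mulf_eq0 (negPf (form_neq0 f_nondeg)) orbF => /eqP.
have y0 : y = 0.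
  rewrite (pihomog_partitionE (leqnn (mmeasure mdeg y))) big1 // => k _.
  case: (ltnP k d) => [/low //|dk].
  by apply: (high (mmeasure mdeg y)) => //; rewrite leq_addl.
have pq0 : p + q = 0 by rewrite pqE y0 mul0r.
have p0 : p = 0.
  have dd : d.+1 != d by rewrite gtn_eqF.
  have : pihomog mdeg d (p + q) = 0 by rewrite pq0 raddf0.
  by rewrite raddfD /= (pihomog_dE hp) (pihomog_ne0 dd hq) addr0.
by split=> //; move: pq0; rewrite p0 add0r.
Qed.

(** * Rotation-stable ideals containing f - lambda *)

Hypothesis ch0 : [pchar K] =i pred0.
Hypothesis n_gt0 : (0 < n)%N.

Section InvariantIdeal.
Variable J : R -> Prop.
Hypothesis JD : forall p q, J p -> J q -> J (p + q).
Hypothesis JM : forall p q, J q -> J (p * q).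
Hypothesis J_level : J (f - lambda%:MP).
Hypothesis J_rotation : forall i j h, J h -> J (rotation f i j h).

Lemma invariant_ideal_level h : h \in level_ideal -> J h.
Proof. by move=> /principalP[y ->]; apply: JM. Qed.

Lemma invariant_idealZ c h : J h -> J (c *: h).
Proof. by move=> Jh; rewrite -mul_mpolyC; apply: JM. Qed.

Lemma invariant_ideal0 : J 0.
Proof. by rewrite -(mul0r (f - lambda%:MP)); apply: JM. Qed.

Lemma invariant_ideal_sum (F : 'I_n.+1 -> R) : (forall i, J (F i)) -> J (\sum_i F i).
Proof. by move=> JF; apply: big_ind => //; apply: invariant_ideal0. Qed.

(** The element is congruent to the sum of the x_i D_ij h: Euler's identity for f
    gives 2 f in front of dh/dx_j, and f is congruent to lambda. *)
Lemma invariant_ideal_mderiv h j : J h ->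
  J ((2 * lambda) *: h^`M(j) - f^`M(j) * \sum_i 'X_i * h^`M(i)).
Proof.
move=> Jh.
have JT : J (\sum_i 'X_i * rotation f i j h).
  by apply: invariant_ideal_sum => i; apply/JM/J_rotation.
have JF : J ((- 2 * h^`M(j)) * (f - lambda%:MP)) by apply: JM.
suff -> : (2 * lambda) *: h^`M(j) - f^`M(j) * (\sum_i 'X_i * h^`M(i)) =
    \sum_i 'X_i * rotation f i j h + (- 2 * h^`M(j)) * (f - lambda%:MP).
  exact: JD.
rewrite /rotation; under [in RHS]eq_bigr => i _ do
  rewrite mulrBr mulrA [X in _ - X]mulrCA.
rewrite sumrB -mulr_suml (euler f_quad) -mulr_sumr.
rewrite -!mul_mpolyC mpolyCM rmorph_nat; ring.
Qed.

(** On a form h of J the Euler operator stays in J, so [invariant_ideal_mderiv]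
    puts all the partial derivatives of h in J; repeated differentiation of a
    nonzero form reaches a nonzero constant. *)
Lemma invariant_ideal_homog d p : p \is d.-homog -> p != 0 -> J p -> J 1.
Proof.
elim: d p => [|d IH] p hp p0 Jp.
  have pE := dhomog0_const hp.
  have -> : 1 = (p@_0)^-1 *: p.
    rewrite [p in _ *: p]pE -mul_mpolyC -mpolyCM mulVf //.
    by apply: contraNneq p0 => c0; rewrite pE c0.
  exact: invariant_idealZ.
have l2 : 2 * lambda != 0 by rewrite mulf_neq0 // pchar0_natf_neq0.
have Jd j : J p^`M(j).
  have JE : J (f^`M(j) * \sum_i 'X_i * p^`M(i)).
    by rewrite (euler hp); apply/JM/invariant_idealZ.
  have := invariant_idealZ (2 * lambda)^-1 (JD (invariant_ideal_mderiv j Jp) JE).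
  by rewrite subrK scalerA mulVf // scale1r.
case: (pickP (fun j => p^`M(j) != 0)) => [j dj|dp].
  exact: (IH _ (dhomog_mderiv j hp)).
case/eqP: p0; apply: (mderiv_eq0_dhomog ch0 (ltn0Sn d) hp) => j.
by have /negbFE/eqP := dp j.
Qed.

(** The degrees of p and q differ in parity, so e is odd once d has reached 0.  To
    lower d, add d f_j (p + q) to [invariant_ideal_mderiv] applied to p + q: the
    term f_j p disappears and what remains is 2 lambda (dp/dx_j) plus a form of
    degree e + 1. *)
Lemma invariant_ideal_pair d e p q : p \is d.-homog -> q \is e.-homog ->
  odd (d + e) -> q != 0 -> J (p + q) -> J 1.
Proof.
elim: d e p q => [|d IH] e p q hp hq de q0 Jpq.
  case: (pickP (fun ij => rotation f ij.1 ij.2 q != 0)) => [[i j] /= nz|inv_q].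
    apply: (invariant_ideal_homog (dhomog_rotation f_quad i j hq) nz).
    have := J_rotation i j Jpq.
    by rewrite rotationD (dhomog0_const hp) rotationC add0r.
  have [|c qE c0] := rotation_invariant ch0 n_gt0 f_quad f_nondeg hq.
    by move=> i j; have /negbFE/eqP := inv_q (i, j).
  by case/eqP: q0; rewrite qE c0 ?scale0r.
have l2 : 2 * lambda != 0 by rewrite mulf_neq0 // pchar0_natf_neq0.
(* The new partner of dp/dx_j, with lambda replaced by f to keep it a form. *)
pose r j : R := 2 *: (f * q^`M(j)) + (d.+1%:R - e%:R) *: (f^`M(j) * q).
have hr j : r j \is e.+1.-homog.
  have h1 : f * q^`M(j) \is (2 + e.-1).-homog.
    exact: (dhomogM f_quad (dhomog_mderiv j hq)).
  have h2 : f^`M(j) * q \is e.+1.-homog.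
    by have := dhomogM (dhomog_grad f_quad j) hq; rewrite add1n.
  rewrite rpredD ?rpredZ //; case: e {IH de h2 r} hq h1 => //= hq _.
  by rewrite mderiv_dhomog0 // mulr0 dhomog0.
have Jr j : J ((2 * lambda) *: p^`M(j) + r j).
  suff -> : (2 * lambda) *: p^`M(j) + r j =
      ((2 * lambda) *: (p + q)^`M(j) -
        f^`M(j) * \sum_i 'X_i * (p + q)^`M(i)) +
      ((2 * q^`M(j)) * (f - lambda%:MP) + (d.+1%:R *: f^`M(j)) * (p + q)).
    by apply: JD; [apply: invariant_ideal_mderiv | apply: JD; apply: JM].
  under eq_bigr => i _ do rewrite mderivD mulrDr.
  rewrite big_split /= (euler hp) (euler hq) /r mderivD.
  rewrite -!mul_mpolyC mpolyCM mpolyCB rmorph_nat.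
  by move: (d.+1%:R)%:MP (e%:R)%:MP => a b; ring.
have [j rj|r0] := pickP (fun j => r j != 0).
  apply: (IH _ _ _ (dhomogZ (2 * lambda) (dhomog_mderiv j hp)) (hr j)) => //.
  by move: de; rewrite addSn addnS.
(* If all r j vanish, then so does the sum of the x_j r j, which Euler's identity
   evaluates to a nonzero multiple of f q. *)
have : \sum_j 'X_j * r j = 0.
  by rewrite big1 // => j _; have /negbFE/eqP-> := r0 j; rewrite mulr0.
have -> : \sum_j 'X_j * r j = (2 * d.+1%:R) *: (f * q).
  transitivity (2 *: (f * \sum_j 'X_j * q^`M(j)) +
    (d.+1%:R - e%:R) *: ((\sum_j 'X_j * f^`M(j)) * q)).
    rewrite mulr_sumr mulr_suml !scaler_sumr -big_split; apply: eq_bigr => j _ /=.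
    by rewrite /r -!mul_mpolyC; ring.
  rewrite (euler hq) (euler f_quad) -!mul_mpolyC mpolyCM mpolyCB.
  by move: (d.+1%:R)%:MP (e%:R)%:MP => a b; ring.
move/eqP; rewrite scaler_eq0 !mulf_eq0 (negPf (form_neq0 f_nondeg)) (negPf q0).
by rewrite !(negPf (pchar0_natf_neq0 ch0 _)).
Qed.

Lemma invariant_ideal_full h : J h -> h \notin level_ideal -> J 1.
Proof.
move=> Jh nh; have [d [p [q [hp hq hpq]]]] := level_ideal_homogenize h.
have Jpq : J (p + q).
  have -> : p + q = h + - (h - (p + q)) by rewrite opprB [RHS]addrCA subrr addr0.
  by apply: JD => //; apply: invariant_ideal_level; rewrite rpredN.
have [q0|q0] := eqVneq q 0; last first.
  by apply: (invariant_ideal_pair hp hq); rewrite // addnS /= addnn odd_double.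
apply: (invariant_ideal_homog hp); last by rewrite q0 addr0 in Jpq.
by apply: contraNneq nh => p0; rewrite p0 q0 addr0 subr0 in hpq.
Qed.

End InvariantIdeal.

(** The two forms representing h stay in adjacent degrees under a rotation, so by
    [level_ideal_pair] both are invariant; an even invariant is a multiple of a
    power of f, hence congruent to a constant. *)
Lemma rotation_center h : (forall i j, rotation f i j h \in level_ideal) ->
  exists a, h - a%:MP \in level_ideal.
Proof.
move=> inv_h; have [d [p [q [hp hq hpq]]]] := level_ideal_homogenize h.
have inv_pq i j : rotation f i j p = 0 /\ rotation f i j q = 0.
  apply: (level_ideal_pair (dhomog_rotation f_quad i j hp)
    (dhomog_rotation f_quad i j hq)).
  have -> : rotation f i j p + rotation f i j q =
      rotation f i j h - rotation f i j (h - (p + q)).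
    by rewrite -rotationD -{1}(subrK (p + q) h) [X in X - _]rotationD addrAC subrr add0r.
  rewrite rpredB //; have /principalP[y ->] := hpq.
  apply/principalP; exists (rotation f i j y).
  rewrite rotationM [rotation f i j (_ - _)]rotationD -mpolyCN.
  by rewrite rotation_form rotationC addr0 mulr0 addr0.
have [|a pE _] := rotation_invariant ch0 n_gt0 f_quad f_nondeg hp.
  by move=> i j; case: (inv_pq i j).
have [|b qE b0] := rotation_invariant ch0 n_gt0 f_quad f_nondeg hq.
  by move=> i j; case: (inv_pq i j).
exists (a * lambda ^+ d).
have -> : h - (a * lambda ^+ d)%:MP =
    (h - (p + q)) + (a * lambda ^+ d)%:MP * ((lambda^-1 *: f) ^+ d - 1).
  have -> : q = 0 by rewrite qE b0 ?scale0r //= odd_double.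
  rewrite pE doubleK exprZn -!mul_mpolyC mulrBr mulr1 mulrA -mpolyCM.
  by rewrite -mulrA -exprMn divff // expr1n mulr1 addr0 addrA subrK.
by rewrite rpredD // principalM // level_form_exp.
Qed.

End LevelSet.

(** * Rotations as brackets *)

Lemma perm_pair (T : finType) (a b x y : T) : a != b -> x != y ->
  exists s : {perm T}, s a = x /\ s b = y.
Proof.
move=> ab xy; pose t := tperm a x.
have tb : t b != x by rewrite -[X in _ != X](tpermL a x) (inj_eq perm_inj) eq_sym.
exists (t * tperm (t b) y)%g; rewrite !permM (tpermL (t b)); split=> //.
by rewrite /t tpermL -/t tpermD // eq_sym.
Qed.

(** Expand the rows x and y: only the two unit vectors missing from the other rows
    contribute. *)
Lemma rdet_perm_rows2 (R : comNzRingType) m (s : 'S_m) k l (x y : 'rV[R]_m) :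
  k != l ->
  rdet (set_at k x (set_at l y [ffun i => delta_mx 0 (s i)])) =
  (-1) ^+ odd_perm s * (x 0 (s k) * y 0 (s l) - x 0 (s l) * y 0 (s k)).
Proof.
move=> kl; have lk : l != k by rewrite eq_sym.
pose h : {ffun 'I_m -> 'rV[R]_m} := [ffun i => delta_mx 0 (s i)].
pose c a b := rdet (set_at k (delta_mx 0 a) (set_at l (delta_mx 0 b) h)).
have ckl : c (s k) (s l) = (-1) ^+ odd_perm s.
  have hE i : delta_mx 0 (s i) = h i by rewrite ffunE.
  rewrite /c !hE set_at_id -[in X in set_at k X]hE hE set_at_id.
  have -> : h = [ffun i => [ffun j => delta_mx 0 j] (s i)].
    by apply/ffunP => i; rewrite !ffunE.
  rewrite rdet_perm -[RHS]mulr1; congr (_ * _); rewrite -(det1 R m).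
  congr (\det _).
  by apply/matrixP => i j; rewrite !mxE ffunE mxE eqxx eq_sym.
have clk : c (s l) (s k) = - (-1) ^+ odd_perm s.
  by rewrite -ckl /c rdet_swap.
have c0 a b : (a, b) != (s k, s l) -> (a, b) != (s l, s k) -> c a b = 0.
  move=> n1 n2; have [ab|ab] := eqVneq a b.
    apply: (rdet_alt kl).
    by rewrite set_atE ffunE (negPf lk) set_atE ab.
  have other z : z != s k -> z != s l ->
      exists2 i, (i != k) && (i != l) & delta_mx 0 z = h i.
    move=> zk zl; exists (s^-1 z)%g; last by rewrite ffunE permKV.
    by apply/andP; split; [apply: contraNneq zk | apply: contraNneq zl];
       move=> <-; rewrite permKV.
  have [ak|ak] := eqVneq a (s k).
    have [||i /andP[ik il] hi] := other b; first by rewrite -ak eq_sym.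
      by apply: contraNneq n1 => ->; rewrite ak.
    apply: (rdet_alt il).
    by rewrite !ffunE (negPf ik) (negPf il) eqxx (negPf lk) hi ffunE.
  have [al|al] := eqVneq a (s l).
    have [||i /andP[ik il] hi] := other b; last 1 first.
    + apply: (rdet_alt il).
      by rewrite !ffunE (negPf ik) (negPf il) eqxx (negPf lk) hi ffunE.
    + by apply: contraNneq n2 => ->; rewrite al.
    by rewrite -al eq_sym.
  have [i /andP[ik il] hi] := other a ak al.
  by apply: (rdet_alt ik); rewrite !ffunE (negPf ik) (negPf il) eqxx hi ffunE.
transitivity (\sum_(p : 'I_m * 'I_m) x 0 p.1 * (y 0 p.2 * c p.1 p.2)).
  rewrite -(pair_bigA _ (fun a b => x 0 a * (y 0 b * c a b))) /=.
  rewrite rdet_row; apply: eq_bigr => a _; rewrite set_atC // rdet_row mulr_sumr.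
  by apply: eq_bigr => b _; rewrite set_atC.
rewrite (bigD1 (s k, s l)) //= (bigD1 (s l, s k)) /=; last first.
  by rewrite xpair_eqE (inj_eq perm_inj) (negPf lk).
rewrite big1 ?addr0 => [|[a b] /andP[n1 n2]]; last by rewrite c0 //= !mulr0.
by rewrite ckl clk; move: (_ ^+ odd_perm s) => e; ring.
Qed.

(** The other n - 1 entries are the coordinates different from x_i and x_j, and the
    last row of the Jacobian matrix is the gradient of f. *)
Lemma jacobian_br_rotation (K : fieldType) n (f : {mpoly K[n.+1]})
    (i j : 'I_n.+1) (k : 'I_n) : i != j ->
  exists (b : bool) (g : {ffun 'I_n -> {mpoly K[n.+1]}}), forall h,
    jacobian_br f (set_at k h g) = (-1) ^+ b * rotation f i j h.
Proof.
move=> ij; have ji : j != i by rewrite eq_sym.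
have km : lift ord_max k != ord_max by rewrite eq_sym neq_lift.
have [s [sk sm]] := perm_pair km ji.
exists (odd_perm s), [ffun l => 'X_(s (lift ord_max l))] => h.
have -> : rotation f i j h = h^`M(j) * f^`M(i) - h^`M(i) * f^`M(j).
  by rewrite /rotation; ring.
have := rdet_perm_rows2 s (\row_a h^`M(a)) (\row_a f^`M(a)) km.
rewrite !mxE sk sm => <-.
rewrite /jacobian_br /jacobian; congr (\det _); apply/matrixP => a b.
rewrite stack_set !mxE !ffunE; case: eqP => _; first by rewrite mxE.
case: (unliftP ord_max a) => [l ->|->] /=; last by rewrite eqxx mxE.
rewrite eq_sym (negPf (neq_lift _ _)) ffunE !mxE eqxx mderivX mnm1E.
case: eqVneq => [->|_]; last by rewrite scale0r.
by rewrite scale1r -[X in (X - _)%MM]add0m addmK mpolyX0.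
Qed.

(** * The algebra P(L(f)) / (f - lambda) *)

(** The row space of the Hessian contains every bracket, hence is an ideal of
    L(f). *)
Lemma simple_nondegenerate (K : fieldType) n (f : {mpoly K[n.+1]}) :
  nlie_simple (Lform f) -> hessian f \in unitmx.
Proof.
move=> [[u nz] simple_f].
have brS v : (Lform_br f v <= hessian f)%MS.
  apply: summx_sub => i _; apply: scalemx_sub.
  by have := row_sub i (hessian f); rewrite rowK.
have [||all_in] := simple_f (fun x : 'rV[K]_n.+1 => (x <= hessian f)%MS).
- split=> [|a x y hx hy|v i _ _]; [exact: sub0mx | | exact: brS].
  by rewrite addmx_sub ?scalemx_sub.
- by move=> H0; case: nz; apply: H0; apply: brS.
by rewrite -row_full_unit -sub1mx; apply/row_subP => i; apply: all_in.
Qed.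

(** A derivation kills 1, and the bracket is a K-linear derivation in each
    argument. *)
Lemma nlp_br_scalar (K : fieldType) n (P : nLiePoissonAlgebra K n)
    (g : {ffun 'I_n -> P}) i a : nlp_br (set_at i (nlp_scalar P a) g) = 0.
Proof.
have br0 : nlp_br (set_at i 0 g) = 0.
  have := nlp_multilinear g i 1 0 0; rewrite rmorph1 !mul1r addr0.
  by move/eqP; rewrite -subr_eq subrr => /eqP/esym.
have br1 : nlp_br (set_at i 1 g) = 0.
  have := nlp_leibniz g i 1 1; rewrite !mul1r mulr1.
  by move/eqP; rewrite -subr_eq subrr => /eqP/esym.
by have := nlp_multilinear g i a 1 0; rewrite mulr1 addr0 br0 br1 mulr0 addr0.
Qed.

Section Quotient.
Variables (K : fieldType) (n : nat) (f : {mpoly K[n.+1]}) (lambda : K).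
Local Notation R := {mpoly K[n.+1]}.
Local Notation level_ideal := (principal (f - lambda%:MP)).
Local Notation Q := (LformP_mod f lambda).
Local Notation pi := (@to_pquot R (f - lambda%:MP) : R -> Q).

Lemma level_class_eq0 h : pi h = 0 <-> h \in level_ideal.
Proof. by rewrite -[h in h \in _]subr0 -eq_pquot raddf0. Qed.

Lemma level_br_rotation i j (k : 'I_n) : i != j ->
  exists (b : bool) (g : {ffun 'I_n -> Q}), forall h,
    nlp_br (set_at k (pi h) g) = (-1) ^+ b * pi (rotation f i j h).
Proof.
move=> ij; have [b [g gE]] := jacobian_br_rotation f k ij.
exists b, [ffun l => pi (g l)] => h.
have -> : set_at k (pi h) [ffun l => pi (g l)] = [ffun l => pi (set_at k h g l)].
  by apply/ffunP => l; rewrite !ffunE; case: eqP.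
have brE : pi (jacobian_br f (set_at k h g)) =
    @nlp_br K n Q [ffun l => pi (set_at k h g l)].
  exact: (@pquot_brE K n (LformP f) (f - lambda%:MP) (LformP_casimir f lambda)).
by rewrite -brE gE rmorphM rmorphXn rmorphN1.
Qed.

End Quotient.

Theorem corollary3 (K : fieldType) (n : nat) (f : {mpoly K[n.+1]}) (lambda : K)
    (charK0 : [pchar K] =i pred0)
    (n_ge2 : (2 <= n)%N)
    (f_quadratic : f \is 2.-homog)
    (Lf_simple : nlie_simple (Lform f))
    (lambda_neq0 : lambda != 0) :
  nlp_central (LformP_mod f lambda) /\ nlp_simple (LformP_mod f lambda).
Proof.
have f_nondeg := simple_nondegenerate Lf_simple.
have n_gt0 : (0 < n)%N by apply: ltnW.
pose pi : {mpoly K[n.+1]} -> LformP_mod f lambda :=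
  @to_pquot {mpoly K[n.+1]} (f - lambda%:MP).
have piK (x : LformP_mod f lambda) : exists h, x = pi h.
  by exists (of_pquot x); rewrite /pi of_pquotK.
split; first split.
- move=> a b /eq_pquot; rewrite -[_ - _]addr0 => ab.
  have hab : (a%:MP - b%:MP : {mpoly K[n.+1]}) \is 0.-homog.
    by rewrite -mpolyCB -[_%:MP]mulr1 mul_mpolyC dhomogZ ?dhomog1.
  have [/eqP + _] := level_ideal_pair f_quadratic lambda_neq0 f_nondeg hab
    (dhomog0 _ _ 1%N) ab.
  by rewrite -mpolyCB mpolyC_eq0 subr_eq0 => /eqP.
- move=> c; split=> [c_central|[a ->] g i _]; last exact: nlp_br_scalar.
  have [h hE] := piK c; rewrite hE in c_central *.
  have [|a ha] := rotation_center f_quadratic lambda_neq0 f_nondeg charK0 n_gt0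
    (h := h).
    move=> i j; have [<-|ij] := eqVneq i j; first by rewrite /rotation subrr rpred0.
    have [b [g gE]] := level_br_rotation f lambda (Ordinal n_gt0) ij.
    apply/level_class_eq0; have := gE h; rewrite c_central //.
    by case: b {gE} => /esym; rewrite ?expr1 ?expr0 ?mulN1r ?mul1r // => /eqP;
       rewrite oppr_eq0 => /eqP.
  by exists a; apply/eq_pquot.
move=> I [I0 ID IM Ibr].
have [[h [Ih nh]]|none] := boolp.EM
    (exists h, I (pi h) /\ h \notin principal (f - lambda%:MP)).
  right=> x; rewrite -[x]mulr1; apply: (IM).
  apply: (invariant_ideal_full f_quadratic lambda_neq0 f_nondeg
    charK0 n_gt0 (J := fun h => I (pi h)) _ _ _ _ Ih nh).
  - by move=> p q Ip Iq; rewrite /pi raddfD; apply: ID.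
  - by move=> p q Iq; rewrite /pi rmorphM; apply: IM.
  - suff -> : pi (f - lambda%:MP) = 0 by [].
    by apply/level_class_eq0/principalP; exists 1; rewrite mul1r.
  move=> i j p Ip; have [<-|ij] := eqVneq i j.
    by rewrite /rotation subrr /pi raddf0.
  have lt : (n.-1 < n)%N by rewrite prednK.
  have [b [g gE]] := level_br_rotation f lambda (Ordinal lt) ij.
  have -> : pi (rotation f i j p) = (-1) ^+ b * ((-1) ^+ b * pi (rotation f i j p)).
    by rewrite mulrA -expr2 sqrr_sign mul1r.
  apply: (IM); rewrite -gE; apply: (Ibr _ (Ordinal lt)); first by rewrite /= prednK.
  by rewrite set_atE.
left=> x; have [h ->] := piK x => Ih; apply/level_class_eq0.
by apply/negP => nh; apply: none; exists h; split=> //; apply/negP.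
Qed.
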